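(* Let $\gamma\in(0,1)$ and $\tau>0$. Assume $|\phi(s,a)|\le1$ for all $(s,a)\in S\times A$, $\lambda_\beta>0$, and $\eta_0>\frac\tau\Gamma$. Suppose that $\eta$ is differentiable and there exists $\alpha>0$ such that $\frac{d}{dt}\eta_t\le\alpha\eta_t$ for all $t\ge0$. Let $(\theta_t,\pi_t)_{t\ge0}$ be a trajectory of the actor-critic flow with $\theta_0\in\mathbb R^N$, $\pi_0\in\Pi_\mu$. Then there exist $r_1,r_2>0$ such that for all $t\ge0$, $$|\theta_t|\le r_1e^{r_2t}.$$
   Context: Setting. $S$ and $A$ are Polish spaces with their Borel $\sigma$-fields; $B_b(E)$ is the space of bounded measurable $f:E\to\mathbb R$ with $|f|_{B_b(E)}=\sup_E|f|$; $\mathcal P(E)$ is the set of Borel probability measures on $E$; $\mathcal P(A|S)$ is the set of probability kernels from $S$ to $A$ (similarly $\mathcal P(S|S\times A)$); $|\cdot|$, $\langle\cdot,\cdot\rangle$ are the Euclidean norm and inner product on $\mathbb R^N$. $P\in\mathcal P(S|S\times A)$ is a transition kernel, $c\in B_b(S\times A)$ a cost, $\gamma\in(0,1)$ a discount factor, $\tau>0$ a regularisation parameter, $\mu\in\mathcal P(A)$ a reference measure. $\operatorname{KL}(m|m')=\int\ln\frac{dm}{dm'}\,dm$ if $m\ll m'$ and $+\infty$ otherwise. Policies. $\Pi_\mu$ is the set of $\pi\in\mathcal P(A|S)$ of the form $\pi(da|s)=\frac{e^{f(s,a)}}{\int_Ae^{f(s,a')}\mu(da')}\mu(da)$ with $f\in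 B_b(S\times A)$; $\ln\frac{d\pi}{d\mu}(s,a)$ denotes the corresponding element $f-\ln\int_A e^f d\mu$ of $B_b(S\times A)$. Occupancy measure. $P^\pi(ds',da'|s,a)=P(ds'|s,a)\pi(da'|s')$ and, for $\beta\in\mathcal P(S\times A)$, $d^\pi_\beta(ds,da)=(1-\gamma)\sum_{n\ge0}\gamma^n\int_{S\times A}(P^\pi)^n(ds,da|s',a')\beta(ds',da')$ (the $0$-th power is the Dirac kernel). Critic. $\phi:S\times A\to\mathbb R^N$ is a measurable feature map, $\beta\in\mathcal P(S\times A)$ is fixed, $Q(s,a;\theta)=\langle\theta,\phi(s,a)\rangle$. Bellman operator: $\mathrm T^\pi f(s,a)=c(s,a)+\gamma\int_{S\times A}f(s',a')P^\pi(ds',da'|s,a)+\tau\gamma\int_S\operatorname{KL}(\pi(\cdot|s')|\mu)P(ds'|s,a)$. Semi-gradient: $g(\theta,\pi)=\int_{S\times A}\big(Q(s,a;\theta)-\mathrm T^\pi Q(\cdot,\cdot;\theta)(s,a)\big)\phi(s,a)\,d^\pi_\beta(ds,da)$. $\lambda_\beta=\lambda_{\min}\big(\int_{S\times A}\phi\phi^\top d\beta\big)$ is the smallest eigenvalue, and $\Gamma=\lambda_\beta(1-\gamma)(1-\sqrt\gamma)$. Actor-critic flow. Let $\eta:[0,\infty)\to[1,\infty)$ be non-decreasing. A trajectory of the flow is a pair $(\theta_t,\pi_t)_{t\ge0}$ with $\theta_t\in\mathbb R^N$, $\pi_t\in\Pi_\mu$, $t\mapsto\theta_t$ and $t\mapsto\ln\frac{d\pi_t}{d\mu}\in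 B_b(S\times A)$ differentiable, and $$\frac{d\theta_t}{dt}=-\eta_t\,g(\theta_t,\pi_t),\qquad \partial_t\pi_t(da|s)=-A(s,a;\theta_t)\,\pi_t(da|s)\ \ \Big(\text{i.e. }\partial_t\ln\tfrac{d\pi_t}{d\mu}(s,a)=-A(s,a;\theta_t)\Big),$$ where $A(s,a;\theta_t)=Q(s,a;\theta_t)+\tau\ln\frac{d\pi_t}{d\mu}(s,a)-\int_A\big(Q(s,a';\theta_t)+\tau\ln\frac{d\pi_t}{d\mu}(s,a')\big)\pi_t(da'|s)$. *)

(* Defs.v *)
From HB Require Import structures.
From mathcomp Require Import all_boot all_order all_algebra.
From mathcomp Require Import all_classical all_reals all_analysis.
From mathcomp Require Import measurable_realfun.

Set Implicit Arguments.
Unset Strict Implicit.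
Unset Printing Implicit Defensive.
Import Order.TTheory GRing.Theory Num.Theory.
Import numFieldNormedType.Exports.

Local Open Scope classical_set_scope.
Local Open Scope ring_scope.

Definition complete_metrization (R : realType) (T : topologicalType)
    (d : T -> T -> R) : Prop :=
  [/\ (forall x y, d x y = 0 <-> x = y),
      (forall x y, d x y = d y x),
      (forall x y z, d x z <= d x y + d y z),
      (forall U : set T, open U <->
         forall x, U x -> exists2 e, 0 < e & [set y | d x y < e] `<=` U) &
      (forall u : nat -> T,
         (forall e, 0 < e -> exists n : nat,
            forall i j, (n <= i)%N -> (n <= j)%N -> d (u i) (u j) < e) ->
         exists l : T, u @ \oo --> l)].

Definition polish (R : realType) (T : topologicalType) : Prop :=
  (exists d : T -> T -> R, complete_metrization d) /\
  (exists2 D : set T, countable D & dense D).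

(* The type T with its Borel sigma-algebra.  On a product of two such types the
   library puts the product sigma-algebra, which for Polish (more generally,
   second countable) spaces is the Borel sigma-algebra of the product. *)
Notation borel T := (g_sigma_algebraType (@open T)).

Section bounded_measurable_functions.
Context d (E : measurableType d) (R : realType).

Definition bounded_measurable : {pred (E -> R)} :=
  mem [set f : E -> R | measurable_fun setT f /\ exists M, forall x, `|f x| <= M].

Lemma bounded_measurable_submod_closed : submod_closed bounded_measurable.
Proof.
split=> [|k f g]; rewrite !inE /=.
  split; first exact: measurable_cst.
  by exists 0 => x; rewrite normr0.
move=> [mf [M fM]] [mg [M' gM']]; split.
  by apply: measurable_funD => //; exact: measurable_funM.
exists (`|k| * M + M') => x.
by rewrite (le_trans (ler_normD _ _))// lerD// normrM ler_wpM2l.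
Qed.

HB.instance Definition _ := GRing.isSubmodClosed.Build R (E -> R)
  bounded_measurable bounded_measurable_submod_closed.

Record Bb := MkBb {
  Bb_fun :> E -> R ;
  Bb_funP : Bb_fun \in bounded_measurable }.

HB.instance Definition _ := [isSub for Bb_fun].
HB.instance Definition _ := [Choice of Bb by <:].
HB.instance Definition _ := [SubChoice_isSubLmodule of Bb by <:].

Definition Bb_norm (f : Bb) : R := sup [set `|f x| | x in setT].

Lemma Bb_has_sup (f : Bb) : has_sup [set `|f x| | x in setT].
Proof.
split; first by exists `|f point|, point.
have := Bb_funP f; rewrite inE => -[_ [M fM]].
by exists M => _ [x _ <-].
Qed.

Lemma Bb_norm_ub (f : Bb) x : `|f x| <= Bb_norm f.
Proof. by apply: (ub_le_sup (proj2 (Bb_has_sup f))); exists x. Qed.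

Lemma Bb_norm_le (f : Bb) M : (forall x, `|f x| <= M) -> Bb_norm f <= M.
Proof.
by move=> fM; apply: (ge_sup (proj1 (Bb_has_sup f))) => _ [x _ <-].
Qed.

Lemma Bb_normD (f g : Bb) : Bb_norm (f + g) <= Bb_norm f + Bb_norm g.
Proof.
apply: Bb_norm_le => x.
by rewrite (le_trans (ler_normD _ _))// lerD// Bb_norm_ub.
Qed.

Lemma Bb_normZ (k : R) (f : Bb) : Bb_norm (k *: f) = `|k| * Bb_norm f.
Proof.
have le_norm (l : R) (g : Bb) : Bb_norm (l *: g) <= `|l| * Bb_norm g.
  by apply: Bb_norm_le => x; rewrite normrM ler_wpM2l// Bb_norm_ub.
apply/eqP; rewrite eq_le le_norm/=.
have [->|k0] := eqVneq k 0.
  rewrite normr0 mul0r.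
  by rewrite (le_trans _ (Bb_norm_ub _ point)).
by rewrite -ler_pdivlMl ?normr_gt0// -normfV -{1}[f]scale1r
  -(mulVf k0) -scalerA le_norm.
Qed.

Lemma Bb_norm0_eq0 (f : Bb) : Bb_norm f = 0 -> f = 0.
Proof.
move=> f0; apply: val_inj; apply/funext => x /=.
by apply/eqP; rewrite -normr_le0 -f0 Bb_norm_ub.
Qed.

HB.instance Definition _ :=
  Lmodule_isNormed.Build R Bb Bb_normD Bb_normZ Bb_norm0_eq0.

End bounded_measurable_functions.

Section euclidean.
Context (R : realType) (N : nat).

Definition dotp (u v : 'cV[R]_N) : R := \sum_(i < N) u i 0 * v i 0.

(* The norm `|u| that the library puts on 'cV[R]_N is the max norm. *)
Definition enorm (u : 'cV[R]_N) : R := Num.sqrt (dotp u u).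

(* The set of eigenvalues is finite, and nonempty for M symmetric and 0 < N, so
   this inf is then a minimum; for N = 0 it is the inf of the empty set, 0. *)
Definition lambda_min (M : 'M[R]_N) : R := inf [set a : R | eigenvalue M a].

End euclidean.

(* Differentiation on [0, +oo[: one-sided at 0, and two-sided elsewhere. *)
Section derivative_halfline.
Context (R : realType) (V : normedModType R).

Definition halfline_quotient (f : R -> V) (t : R) : set_system V :=
  (fun s => (s - t)^-1 *: (f s - f t)) @ within [set s | 0 <= s] t^'.

Definition derivable_halfline (f : R -> V) (t : R) : Prop :=
  cvg (halfline_quotient f t).

Definition derive_halfline (f : R -> V) (t : R) : V :=
  lim (halfline_quotient f t).

End derivative_halfline.

Section kernel_value.
Context d d' (X : measurableType d) (Y : measurableType d') (R : realType).
Variables (k : R.-pker X ~> Y) (x : X).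

Definition kernel_value : set Y -> \bar R := k x.

HB.instance Definition _ := Measure.on kernel_value.
HB.instance Definition _ :=
  Measure_isProbability.Build _ _ _ kernel_value (prob_kernel x).

End kernel_value.

Section KL.
Context d (T : measurableType d) (R : realType).
Local Open Scope ereal_scope.
Local Open Scope charge_scope.

Definition KL (m m' : probability T R) : \bar R :=
  if `[< m `<< m' >] then
    \int[m]_x (ln (fine (('d (charge_of_finite_measure m) '/d m') x)))%:E
  else +oo.

End KL.

Section markov_decision_process.
Context dS dA (S : measurableType dS) (A : measurableType dA) (R : realType).
Local Notation SA := (S * A)%type.

Section policies.
Variable mu : probability A R.

Definition gibbs_normalisation (f : SA -> R) (s : S) : R :=
  \int[mu]_a expR (f (s, a)).

Definition gibbs_policy (f : Bb SA R) (pi : R.-pker S ~> A) : Prop :=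
  forall s (B : set A), measurable B ->
    pi s B =
    (\int[mu]_(a in B) (expR (f (s, a)) / gibbs_normalisation f s)%:E)%E.

Definition Pi_mu (pi : R.-pker S ~> A) : Prop := exists f, gibbs_policy f pi.

(* The element f of B_b in the Gibbs form of pi, hence also l, is determined by
   pi only up to a mu-null set of actions for each state. *)
Definition is_log_density (pi : R.-pker S ~> A) (l : Bb SA R) : Prop :=
  exists2 f : Bb SA R, gibbs_policy f pi &
    forall s a, l (s, a) = f (s, a) - ln (gibbs_normalisation f s).

Lemma is_log_density_Pi_mu pi l : is_log_density pi l -> Pi_mu pi.
Proof. by case=> f fpi _; exists f. Qed.

End policies.

Section state_action_kernel.
Variables (P : R.-pker SA ~> S) (pi : R.-pker S ~> A).

(* P(ds'|s,a) pi(da'|s') *)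
Definition state_action_kernel : SA -> {measure set SA -> \bar R} :=
  mkproduct P (@kernel.kernel_snd _ _ _ SA S A R pi).

HB.instance Definition _ := Kernel.on state_action_kernel.

Lemma state_action_kernelE x (B : set SA) :
  state_action_kernel x B = kproduct_snd P pi x B.
Proof. by []. Qed.

Let state_action_kernel_prob x : state_action_kernel x setT = 1%E.
Proof.
rewrite state_action_kernelE /kproduct_snd /kproduct.
transitivity (\int[P x]_y (cst 1 y))%E; last first.
  by rewrite integral_cst// mul1e prob_kernel.
apply: eq_integral => y _ /=.
transitivity (\int[pi y]_z (cst 1 z))%E; last first.
  by rewrite integral_cst// mul1e prob_kernel.
by apply: eq_integral => z _; rewrite indicT.
Qed.

HB.instance Definition _ :=
  Kernel_isProbability.Build _ _ _ _ _ state_action_kernel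
    state_action_kernel_prob.

End state_action_kernel.

Fixpoint kernel_pow (K : R.-pker SA ~> SA) (n : nat) : R.-spker SA ~> SA :=
  if n is m.+1 then mkcomp_noparam (kernel_pow K m) K
  else kdirac (@measurable_id _ SA setT).

Section kernel_law.
Variables (beta : probability SA R) (k : R.-ker SA ~> SA).
Local Open Scope ereal_scope.

Definition kernel_law (B : set SA) : \bar R := \int[beta]_x k x B.

Let kernel_law0 : kernel_law set0 = 0.
Proof. by apply: integral0_eq => x _; rewrite measure0. Qed.

Let kernel_law_ge0 B : 0 <= kernel_law B.
Proof. by apply: integral_ge0 => x _; exact: measure_ge0. Qed.

Let kernel_law_sigma_additive : semi_sigma_additive kernel_law.
Proof.
move=> F mF tF mUF.
rewrite [X in _ --> X](_ : _ = \sum_(n <oo) kernel_law (F n)).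
  by apply: is_cvg_ereal_nneg_natsum => n _; exact: kernel_law_ge0.
rewrite /kernel_law -integral_nneseries//.
  by apply: eq_integral => x _; rewrite measure_semi_bigcup.
by move=> n; exact: measurable_kernel.
Qed.

HB.instance Definition _ := isMeasure.Build _ _ _ kernel_law
  kernel_law0 kernel_law_ge0 kernel_law_sigma_additive.

End kernel_law.

Section occupancy.
Variables (gamma : R) (gamma01 : 0 < gamma < 1).
Variables (P : R.-pker SA ~> S) (pi : R.-pker S ~> A) (beta : probability SA R).

Let gamma_ge0 n : 0 <= gamma ^+ n.
Proof. by case/andP: gamma01 => /ltW g0 _; rewrite exprn_ge0. Qed.

Let one_minus_gamma_ge0 : 0 <= 1 - gamma.
Proof. by case/andP: gamma01 => _ /ltW g1; rewrite subr_ge0. Qed.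

Definition occupancy : {measure set SA -> \bar R} :=
  mscale (NngNum one_minus_gamma_ge0)
    (mseries (fun n => mscale (NngNum (gamma_ge0 n))
       (kernel_law beta (kernel_pow (state_action_kernel P pi) n))) 0).

Lemma occupancyE (B : set SA) : occupancy B =
  ((1 - gamma)%:E * \sum_(0 <= n <oo) ((gamma ^+ n)%:E *
     \int[beta]_x kernel_pow (state_action_kernel P pi) n x B))%E.
Proof. by []. Qed.

End occupancy.

Section actor_critic.
Variables (N : nat) (phi : SA -> 'cV[R]_N).
Variables (P : R.-pker SA ~> S) (c : Bb SA R) (mu : probability A R).
Variables (beta : probability SA R) (tau : R).
Variables (gamma : R) (gamma01 : 0 < gamma < 1).

Definition Qfun (theta : 'cV[R]_N) (x : SA) : R := dotp theta (phi x).

Definition bellman (pi : R.-pker S ~> A) (f : SA -> R) (x : SA) : \bar R :=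
  ((c x)%:E + gamma%:E * \int[state_action_kernel P pi x]_y (f y)%:E
   + (tau * gamma)%:E * \int[P x]_s KL (kernel_value pi s) mu)%E.

Definition semi_gradient (theta : 'cV[R]_N) (pi : R.-pker S ~> A) : 'cV[R]_N :=
  \col_i fine (\int[occupancy gamma01 P pi beta]_x
    (((Qfun theta x)%:E - bellman pi (Qfun theta) x) * (phi x i 0)%:E))%E.

Definition gram : 'M[R]_N :=
  \matrix_(i, j) \int[beta]_x (phi x i 0 * phi x j 0).

Definition lambda_beta : R := lambda_min gram.

Definition Gamma_beta : R :=
  lambda_beta * (1 - gamma) * (1 - Num.sqrt gamma).

Definition advantage (theta : 'cV[R]_N) (pi : R.-pker S ~> A) (l : Bb SA R)
    (s : S) (a : A) : R :=
  Qfun theta (s, a) + tau * l (s, a)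
  - \int[pi s]_a' (Qfun theta (s, a') + tau * l (s, a')).

(* l t is ln(d(pi t)/dmu), normed by the sup norm of Bb; the last clause is
   d/dt pi_t(da|s) = - A(s,a;theta_t) pi_t(da|s) in logarithmic form. *)
Definition actor_critic_flow (eta : R -> R) (theta : R -> 'cV[R]_N)
    (pi : R -> R.-pker S ~> A) : Prop :=
  exists l : R -> Bb SA R, forall t, 0 <= t ->
    [/\ is_log_density mu (pi t) (l t),
        derivable_halfline theta t,
        derivable_halfline l t,
        derive_halfline theta t = - eta t *: semi_gradient (theta t) (pi t) &
        forall s a,
          derive_halfline l t (s, a) = - advantage (theta t) (pi t) (l t) s a].

End actor_critic.

End markov_decision_process.

(* Main.v *)
(* Let x = |theta|, Q = <theta, phi>, let d be the occupancy measure and K the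
   state-action kernel.  Since d >= (1 - gamma) beta and gamma (d K) <= d, the
   Jensen and AM-GM inequalities give
     <theta, g> >= G x^2 - (|c| + tau gamma sup|ln dpi/dmu|) x
   with G = (1 - sqrt gamma) (1 - gamma) kappa > 0, where int Q^2 dbeta >=
   kappa x^2.  The oscillation in the action of the log-density decays at rate
   tau and is driven by 2x, so it is controlled by the integral of x over the
   past.  Hence if x first touched b exp(r t) at time t, with r = 4 tau / G and
   b large, the log-density would still be too small to outweigh G x there, so
   x would be decreasing at t: a contradiction.  As the factor eta only
   multiplies the whole slope of x, its size is irrelevant. *)

Require Import Defs.
From HB Require Import structures.
From mathcomp Require Import all_boot all_order all_algebra.
From mathcomp Require Import all_classical all_reals all_analysis.
From mathcomp Require Import measurable_realfun ring lra.

Set Implicit Arguments.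
Unset Strict Implicit.
Unset Printing Implicit Defensive.
Import Order.TTheory GRing.Theory Num.Theory.
Import numFieldNormedType.Exports.

Local Open Scope classical_set_scope.
Local Open Scope ring_scope.

(** * Bounded measurable functions, as a predicate on plain functions, and their integrals *)

Definition bdd_measurable d (T : measurableType d) (R : realType) (f : T -> R) :
  Prop := measurable_fun setT f /\ exists M, forall x, `|f x| <= M.

Section bdd_measurable.
Context d (T : measurableType d) (R : realType).
Implicit Types f g : T -> R.

Lemma bdd_measurable_cst k : bdd_measurable (fun _ : T => k : R).
Proof. by split; [exact: measurable_cst|exists `|k|]. Qed.

Lemma bdd_measurableD f g : bdd_measurable f -> bdd_measurable g ->
  bdd_measurable (fun x => f x + g x).
Proof.
move=> [mf [M fM]] [mg [M' gM']]; split; first exact: measurable_funD.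
by exists (M + M') => x; rewrite (le_trans (ler_normD _ _))// lerD.
Qed.

Lemma bdd_measurableM f g : bdd_measurable f -> bdd_measurable g ->
  bdd_measurable (fun x => f x * g x).
Proof.
move=> [mf [M fM]] [mg [M' gM']]; split; first exact: measurable_funM.
by exists (M * M') => x; rewrite normrM ler_pM.
Qed.

Lemma bdd_measurableZ k f : bdd_measurable f ->
  bdd_measurable (fun x => k * f x).
Proof. by apply: bdd_measurableM; exact: bdd_measurable_cst. Qed.

Lemma bdd_measurableB f g : bdd_measurable f -> bdd_measurable g ->
  bdd_measurable (fun x => f x - g x).
Proof.
move=> bf bg; have := bdd_measurableD bf (bdd_measurableZ (-1) bg).
by under eq_fun do rewrite mulN1r.
Qed.

Lemma bdd_measurable_sqr f : bdd_measurable f ->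
  bdd_measurable (fun x => f x ^+ 2).
Proof. by move=> bf; have := bdd_measurableM bf bf. Qed.

Lemma bdd_measurable_norm f : bdd_measurable f ->
  bdd_measurable (fun x => `|f x|).
Proof.
move=> [mf [M fM]]; split; first exact: measurableT_comp.
by exists M => x; rewrite normr_id.
Qed.

Lemma bdd_measurable_sum n (F : 'I_n -> T -> R) :
  (forall i, bdd_measurable (F i)) ->
  bdd_measurable (fun x => \sum_(i < n) F i x).
Proof.
elim: n F => [|n IH] F bF.
  under eq_fun do rewrite big_ord0; exact: bdd_measurable_cst.
under eq_fun do rewrite big_ord_recl.
by apply: bdd_measurableD => //; apply: IH => i.
Qed.

Lemma bdd_measurable_Bb (f : Bb T R) : bdd_measurable f.
Proof. by have := Bb_funP f; rewrite inE. Qed.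

Variable m : {measure set T -> \bar R}.
Hypothesis m_fin : (m setT < +oo)%E.

Lemma bdd_measurable_integrable f : bdd_measurable f ->
  m.-integrable setT (EFin \o f).
Proof.
move=> [mf [M fM]]; apply: measurable_bounded_integrable => //.
exists M; split; first exact: num_real.
by move=> x Mx y _ /=; rewrite (le_trans (fM y))// ltW.
Qed.

Lemma EFin_Rintegral f : bdd_measurable f ->
  (\int[m]_x f x)%:E = (\int[m]_x (f x)%:E)%E.
Proof.
move=> bf; rewrite /Rintegral fineK//.
by apply: integrable_fin_num => //; exact: bdd_measurable_integrable.
Qed.

Lemma bdd_RintegralD f g : bdd_measurable f -> bdd_measurable g ->
  \int[m]_x (f x + g x) = \int[m]_x f x + \int[m]_x g x.
Proof.
by move=> bf bg; rewrite RintegralD//; exact: bdd_measurable_integrable.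
Qed.

Lemma bdd_RintegralB f g : bdd_measurable f -> bdd_measurable g ->
  \int[m]_x (f x - g x) = \int[m]_x f x - \int[m]_x g x.
Proof.
by move=> bf bg; rewrite RintegralB//; exact: bdd_measurable_integrable.
Qed.

Lemma bdd_RintegralZ k f : bdd_measurable f ->
  \int[m]_x (k * f x) = k * \int[m]_x f x.
Proof. by move=> bf; rewrite RintegralZl//; exact: bdd_measurable_integrable. Qed.

Lemma bdd_Rintegral_sum n (F : 'I_n -> T -> R) :
  (forall i, bdd_measurable (F i)) ->
  \int[m]_x (\sum_(i < n) F i x) = \sum_(i < n) \int[m]_x F i x.
Proof.
elim: n F => [|n IH] F bF.
  under eq_Rintegral do rewrite big_ord0.
  by rewrite Rintegral_cst// mul0r big_ord0.
under eq_Rintegral do rewrite big_ord_recl.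
by rewrite bdd_RintegralD// ?IH ?big_ord_recl//; exact: bdd_measurable_sum.
Qed.

Lemma bdd_le_Rintegral f g : bdd_measurable f -> bdd_measurable g ->
  (forall x, f x <= g x) -> \int[m]_x f x <= \int[m]_x g x.
Proof.
by move=> bf bg fg; apply: le_Rintegral => //; exact: bdd_measurable_integrable.
Qed.

Lemma Rintegral_norm_le f M : (m setT <= 1)%E -> bdd_measurable f ->
  (forall x, `|f x| <= M) -> `|\int[m]_x f x| <= M.
Proof.
move=> m1 bf fM; have M0 : 0 <= M by rewrite (le_trans _ (fM point)).
rewrite (le_trans (le_normr_Rintegral _ (bdd_measurable_integrable bf)))//.
apply: (@le_trans _ _ (\int[m]_x M)).
  apply: bdd_le_Rintegral => //; first exact: bdd_measurable_norm.
  exact: bdd_measurable_cst.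
rewrite Rintegral_cst// ler_piMr//.
by rewrite -lee_fin fineK ?ge0_fin_numE.
Qed.

End bdd_measurable.
Arguments bdd_measurable_cst {d T R} k.

(** Jensen's inequality for the square: with [e] the mean of [f], expand the nonnegative integral of
    (f - e)^2; unit mass makes the constant term e^2. *)
Lemma Rintegral_sqr_le d (T : measurableType d) (R : realType)
    (m : {measure set T -> \bar R}) (f : T -> R) :
  m setT = 1%E -> bdd_measurable f ->
  (\int[m]_x f x) ^+ 2 <= \int[m]_x (f x ^+ 2).
Proof.
move=> m1 bf; have mfin : (m setT < +oo)%E by rewrite m1 ltry.
set e := \int[m]_x f x.
have : 0 <= \int[m]_x (f x ^+ 2 - 2 * e * f x + e ^+ 2).
  apply: Rintegral_ge0 => x _.
  by have := sqr_ge0 (f x - e); lra.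
have b2f := bdd_measurableZ (2 * e) bf.
have bf2 := bdd_measurable_sqr bf.
rewrite (bdd_RintegralD mfin (bdd_measurableB bf2 b2f) (bdd_measurable_cst _)).
rewrite (bdd_RintegralB mfin bf2 b2f) (bdd_RintegralZ mfin _ bf).
rewrite Rintegral_cst//.
have -> : fine (m setT) = 1 by rewrite m1.
rewrite -/e; nra.
Qed.

(** * Integration against probability kernels and their compositions *)

Section kernel_integral.
Context d d' (X : measurableType d) (Y : measurableType d') (R : realType).

Lemma bdd_measurable_section (f : X * Y -> R) x :
  bdd_measurable f -> bdd_measurable (fun y => f (x, y)).
Proof.
move=> [mf [M fM]]; split; last by exists M => y.
by apply: measurableT_comp => //; exact: pair1_measurable.
Qed.

Lemma bdd_measurable_kernel2 (k : R.-pker X ~> Y) (f : X * Y -> R) :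
  bdd_measurable f -> bdd_measurable (fun x => \int[k x]_y f (x, y)).
Proof.
move=> bf; have [mf [M fM]] := bf.
have kfin x : (k x setT < +oo)%E by rewrite prob_kernel ltry.
split; last first.
  exists M => x; apply: Rintegral_norm_le => //; first by rewrite prob_kernel.
  exact: bdd_measurable_section.
(* Measurability is available for nonnegative integrands, so [f] is shifted up by its bound [M]; as
   [k x] has mass one, subtracting [M] undoes the shift. *)
rewrite (_ : (fun x => _) =
    (fun x => fine (\int[k x]_y (f (x, y) + M)%:E)%E - M)).
  apply: measurable_funB; last exact: measurable_cst.
  apply: measurableT_comp => //.
  apply: (measurable_fun_integral_finite_kernel (fun z => (f z + M)%:E) k).
  - move=> z; rewrite lee_fin -lerBlDr sub0r.
    by have := fM z; rewrite ler_norml => /andP[].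
  - apply/measurable_EFinP; apply: measurable_funD.
      exact: mf.
    exact: measurable_cst.
apply/funext => x; rewrite -[fine _]/(\int[k x]_y (f (x, y) + M)).
rewrite bdd_RintegralD//; last exact: bdd_measurable_cst.
  by rewrite Rintegral_cst// prob_kernel/= mulr1 addrK.
exact: bdd_measurable_section.
Qed.

Lemma bdd_measurable_kernel (k : R.-pker X ~> Y) (f : Y -> R) :
  bdd_measurable f -> bdd_measurable (fun x => \int[k x]_y f y).
Proof.
move=> [mf [M fM]]; apply: (bdd_measurable_kernel2 k (f := f \o snd)).
split; last by exists M => -[x y]; exact: fM.
by apply: measurableT_comp => //; exact: measurable_snd.
Qed.

End kernel_integral.

Section kernel_law_integral.
Context dS dA (S : measurableType dS) (A : measurableType dA) (R : realType).
Local Notation SA := (S * A)%type.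
Local Open Scope ereal_scope.

Lemma ge0_integral_kernel_law (beta : probability SA R) (k : R.-spker SA ~> SA)
    (f : SA -> \bar R) : (forall x, 0 <= f x) -> measurable_fun setT f ->
  \int[kernel_law beta k]_x f x = \int[beta]_x \int[k x]_y f y.
Proof.
move=> f0 mf.
(* Seen as a constant kernel [b], [beta] turns [kernel_law] into a kernel composition, evaluated at
   the arbitrary [point]. *)
pose b := kprobability
  (measurable_cst (beta : pprobability SA R) : measurable_fun [set: SA] _).
rewrite -[RHS](integral_kcomp b (kernel.kernel_snd k) point f0 mf).
by apply: eq_measure_integral => B mB _.
Qed.

Lemma ge0_integral_kcomp_noparam (k1 k2 : R.-spker SA ~> SA) x
    (f : SA -> \bar R) : (forall x, 0 <= f x) -> measurable_fun setT f ->
  \int[mkcomp_noparam k1 k2 x]_y f y = \int[k1 x]_y \int[k2 y]_z f z.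
Proof.
move=> f0 mf.
rewrite -[RHS](integral_kcomp k1 (kernel.kernel_snd k2) x f0 mf).
by apply: eq_measure_integral => B mB _.
Qed.

End kernel_law_integral.

(** * Integration against the occupancy measure *)

Lemma nneseries_shift_le (R : realType) (u : nat -> \bar R) :
  (forall n, (0 <= u n)%E) -> (\sum_(n <oo) u n.+1 <= \sum_(n <oo) u n)%E.
Proof.
move=> u0; rewrite [leRHS]nneseries_recl//.
rewrite (eq_eseriesr (g := fun n => u (n + 1)%N)); last first.
  by move=> n _; rewrite addn1.
by rewrite nneseries_addn// leeDr.
Qed.

Section occupancy_integral.
Context dS dA (S : measurableType dS) (A : measurableType dA) (R : realType).
Local Notation SA := (S * A)%type.
Variables (gamma : R) (gamma01 : 0 < gamma < 1).
Variables (P : R.-pker SA ~> S) (pi : R.-pker S ~> A) (beta : probability SA R).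
Local Notation K := (state_action_kernel P pi).
Local Notation occ := (occupancy gamma01 P pi beta).

Let law n := kernel_law beta (kernel_pow K n).

Let gamma_ge0 : 0 <= gamma. Proof. by case/andP: gamma01 => /ltW. Qed.

Let onem_gamma_ge0 : 0 <= 1 - gamma.
Proof. by case/andP: gamma01 => _ /ltW; rewrite subr_ge0. Qed.

Let term_ge0 (f : SA -> \bar R) : (forall x, (0 <= f x)%E) -> forall n,
  (0 <= (gamma ^+ n)%:E * \int[law n]_x f x)%E.
Proof.
by move=> f0 n; rewrite mule_ge0 ?lee_fin ?exprn_ge0//; apply: integral_ge0.
Qed.

Lemma ge0_integral_occupancy (f : SA -> \bar R) :
  (forall x, 0 <= f x)%E -> measurable_fun setT f ->
  (\int[occ]_x f x = (1 - gamma)%:E *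
     \sum_(n <oo) ((gamma ^+ n)%:E *
       \int[kernel_law beta (kernel_pow (state_action_kernel P pi) n)]_x f x))%E.
Proof.
move=> f0 mf; rewrite /occupancy ge0_integral_mscale//; congr (_ * _)%E.
rewrite ge0_integral_measure_series//; apply: eq_eseriesr => n _.
by rewrite ge0_integral_mscale.
Qed.

(** Only the term n = 0 of the series is kept: the zeroth power is the Dirac kernel, so its law is
    [beta]. *)
Lemma integral_le_occupancy (f : SA -> \bar R) :
  (forall x, 0 <= f x)%E -> measurable_fun setT f ->
  ((1 - gamma)%:E * \int[beta]_x f x <= \int[occ]_x f x)%E.
Proof.
move=> f0 mf; rewrite ge0_integral_occupancy//.
rewrite lee_wpmul2l ?lee_fin//.
apply: (@le_trans _ _
  (\sum_(0 <= n < 1) ((gamma ^+ n)%:E * \int[law n]_x f x))%E).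
  rewrite big_nat1 expr0 mul1e ge0_integral_kernel_law//.
  rewrite le_eqVlt; apply/orP; left; apply/eqP.
  apply: eq_integral => x _ /=.
  by rewrite integral_dirac// diracT mul1e.
by apply: nneseries_lim_ge => n _ _; exact: term_ge0.
Qed.

(** Every kernel power has mass at most one, and the geometric series of [gamma] sums to the inverse
    of 1 - gamma. *)
Lemma occupancy_setT_le1 : (occ setT <= 1)%E.
Proof.
rewrite occupancyE.
have g1 : `|gamma| < 1 by rewrite ger0_norm//; case/andP: gamma01.
have gp : 0 < 1 - gamma by rewrite subr_gt0; case/andP: gamma01.
apply: (@le_trans _ _ ((1 - gamma)%:E * ((1 - gamma)^-1)%:E)%E); last first.
  by rewrite -EFinM mulfV// gt_eqF.
rewrite lee_wpmul2l ?lee_fin//.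
apply: (@le_trans _ _ (\sum_(0 <= n <oo) (gamma ^+ n)%:E)%E).
  apply: lee_nneseries => [n _ _|n _].
    by rewrite mule_ge0 ?lee_fin ?exprn_ge0//; apply: integral_ge0.
  rewrite -[leRHS]mule1 lee_wpmul2l ?lee_fin ?exprn_ge0//.
  apply: (@le_trans _ _ (\int[beta]_x 1)%E).
    apply: ge0_le_integral => //; first exact: measurable_kernel.
    by move=> x _; exact: sprob_kernel_le1.
  by rewrite integral_cst// mul1e; exact: probability_le1.
apply: lime_le.
  by apply: is_cvg_nneseries => n _ _; rewrite lee_fin exprn_ge0.
apply: nearW => n; rewrite sumEFin lee_fin.
have := @geometric_le_lim R n 1 gamma ler01 _ g1; rewrite mul1r.
rewrite /series /geometric/=; under eq_bigr do rewrite mul1r.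
by apply; case/andP: gamma01.
Qed.

(** One application of [K] turns the n-th law into the next one, and [gamma] raises the weight
    accordingly. The left side is thus the series of the right side without its first term. *)
Lemma integral_kernel_le_occupancy (f : SA -> \bar R) :
  (forall x, 0 <= f x)%E -> measurable_fun setT f ->
  (gamma%:E * \int[occ]_x \int[K x]_y f y <= \int[occ]_x f x)%E.
Proof.
move=> f0 mf.
have Kf0 x : (0 <= \int[K x]_y f y)%E by apply: integral_ge0.
have mKf : measurable_fun setT (fun x => \int[K x]_y f y)%E.
  by apply: measurable_fun_integral_kernel => // U mU; exact: measurable_kernel.
rewrite !ge0_integral_occupancy// muleCA lee_wpmul2l ?lee_fin//.
rewrite -nneseriesZl; last by move=> n _; exact: term_ge0.
apply: (@le_trans _ _ (\sum_(n <oo) (gamma ^+ n.+1)%:E * \int[law n.+1]_x f x)%E).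
  apply: lee_nneseries => [n _ _|n _].
    by rewrite mule_ge0 ?lee_fin// term_ge0.
  rewrite muleA -EFinM -exprS.
  rewrite (@ge0_integral_kernel_law _ _ _ _ _ _ (kernel_pow K n))//.
  rewrite (@ge0_integral_kernel_law _ _ _ _ _ _ (kernel_pow K n.+1))//.
  rewrite le_eqVlt; apply/orP; left; apply/eqP; congr (_ * _)%E.
  by apply: eq_integral => x _; rewrite ge0_integral_kcomp_noparam.
exact/nneseries_shift_le/term_ge0.
Qed.

End occupancy_integral.

(** * Log-densities of Gibbs policies and their relative entropy *)

Lemma bdd_measurable_expR d (T : measurableType d) (R : realType) (f : T -> R) :
  bdd_measurable f -> bdd_measurable (fun x => expR (f x)).
Proof.
move=> [mf [M fM]]; split; first exact: measurableT_comp.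
exists (expR M) => x; rewrite ger0_norm ?expR_ge0// ler_expR.
by rewrite (le_trans (ler_norm _)).
Qed.

Section log_density.
Context dS dA (S : measurableType dS) (A : measurableType dA) (R : realType).
Local Notation SA := (S * A)%type.
Variables (mu : probability A R) (pi : R.-pker S ~> A) (l : Bb SA R).
Hypothesis l_pi : is_log_density mu pi l.

Let mu_fin : (mu setT < +oo)%E.
Proof. by rewrite ltey_eq fin_num_measure. Qed.

Let bdd_l s : bdd_measurable (fun a => l (s, a)).
Proof. exact/bdd_measurable_section/bdd_measurable_Bb. Qed.

Let bdd_expl s : bdd_measurable (fun a => expR (l (s, a))).
Proof. exact: bdd_measurable_expR. Qed.

Lemma log_density_expR s (B : set A) : measurable B ->
  pi s B = (\int[mu]_(a in B) (expR (l (s, a)))%:E)%E.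
Proof.
case: l_pi => f fpi lf mB; rewrite fpi//.
have bf : bdd_measurable (fun a => f (s, a)).
  exact/bdd_measurable_section/bdd_measurable_Bb.
have [M fM] := (bdd_measurable_Bb f).2.
(* Once the normalisation is positive, [expR] undoes its logarithm; it is at least exp(-M), where
   [M] bounds [f]. *)
suff Z0 : 0 < gibbs_normalisation mu f s.
  by apply: eq_integral => a _; rewrite lf expRD expRN lnK.
apply: (@lt_le_trans _ _ (\int[mu]_a expR (- M))).
  rewrite Rintegral_cst// mulr_gt0 ?expR_gt0//.
  by rewrite [X in fine X](_ : _ = 1%E) ?ltr01//; exact: probability_setT.
apply: bdd_le_Rintegral => //.
- exact: bdd_measurable_cst.
- exact: bdd_measurable_expR.
- move=> a; rewrite ler_expR lerNl (le_trans _ (fM (s, a)))//.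
  by rewrite -normrN ler_norm.
Qed.

Lemma Rintegral_log_density s : \int[mu]_a expR (l (s, a)) = 1.
Proof.
apply: EFin_inj; rewrite (EFin_Rintegral mu_fin (bdd_expl s)).
by rewrite -log_density_expR// prob_kernel.
Qed.

(* exp(l(s,.)) has mean 1, so l(s,.) takes values of both signs. *)
Lemma log_density_norm_le s M :
  (forall a a', l (s, a) - l (s, a') <= M) -> forall a, `|l (s, a)| <= M.
Proof.
move=> osc a.
have mu1 : fine (mu setT) = 1.
  by rewrite [X in fine X](_ : _ = 1%E)//; exact: probability_setT.
rewrite ler_norml; apply/andP; split.
  rewrite lerNl -ler_expR expRN.
  (* Integrating exp(l(s,a')) <= exp(l(s,a)) exp(M) over a' bounds l(s,a) below by -M; the upper
     bound is symmetric. *)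
  have : \int[mu]_a' expR (l (s, a')) <= \int[mu]_a' (expR (l (s, a)) * expR M).
    apply: bdd_le_Rintegral => //; first exact: bdd_measurable_cst.
    by move=> a'; rewrite -expRD ler_expR -lerBlDl.
  rewrite Rintegral_log_density Rintegral_cst// mu1 mulr1 => h.
  by rewrite -div1r ler_pdivrMr ?expR_gt0// mulrC.
rewrite -ler_expR.
have : \int[mu]_a' (expR (l (s, a)) / expR M) <= \int[mu]_a' expR (l (s, a')).
  apply: bdd_le_Rintegral => //; first exact: bdd_measurable_cst.
  by move=> a'; rewrite -expRN -expRD ler_expR lerBlDr -lerBlDl.
rewrite Rintegral_log_density Rintegral_cst// mu1 mulr1.
by rewrite ler_pdivrMr ?expR_gt0// mul1r.
Qed.

(** The Radon-Nikodym derivative equals exp(l) only [mu]-almost everywhere; since [pi s] is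
    dominated by [mu], the equality also holds almost everywhere for [pi s], where the logarithm is
    integrated. *)
Lemma KL_log_density s :
  KL (kernel_value pi s) mu = (\int[pi s]_a l (s, a))%:E.
Proof.
have dom : null_dominates mu (kernel_value pi s).
  apply/null_content_dominatesP => B mB mB0.
  rewrite [LHS](log_density_expR s mB) null_set_integral//.
  by apply/measurable_funTS/measurable_EFinP; case: (bdd_expl s).
have fin : (pi s setT < +oo)%E by rewrite prob_kernel ltry.
rewrite /KL asboolT// EFin_Rintegral//.
have mRN : mu.-integrable setT
    (Radon_Nikodym (charge_of_finite_measure (kernel_value pi s)) mu).
  exact: Radon_Nikodym_integrable.
have : ae_eq (kernel_value pi s) setT
   (Radon_Nikodym (charge_of_finite_measure (kernel_value pi s)) mu)
   (fun a => (expR (l (s, a)))%:E).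
  apply: (null_dominates_ae_eq _ dom) => //.
  apply: integral_ae_eq => //.
  - by apply/measurable_EFinP; case: (bdd_expl s).
  - move=> B _ mB; rewrite -Radon_Nikodym_integral//.
    exact: log_density_expR.
move=> ae; apply: ae_eq_integral => //.
- apply/measurable_EFinP; apply: measurableT_comp => //.
  apply: measurableT_comp => //; exact: measurable_int mRN.
- by apply/measurable_EFinP; case: (bdd_l s).
- by apply: filterS ae => a ea _; rewrite ea//= expRK.
Qed.

Lemma bdd_measurable_log_density_mean :
  bdd_measurable (fun s => \int[pi s]_a l (s, a)).
Proof. exact/bdd_measurable_kernel2/bdd_measurable_Bb. Qed.

End log_density.

(** * The Euclidean norm *)

Section euclidean_norm.
Context (R : realType) (N : nat).
Implicit Types u v : 'cV[R]_N.

Lemma dotpp_ge0 u : 0 <= dotp u u.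
Proof. by apply: sumr_ge0 => i _; rewrite -expr2 sqr_ge0. Qed.

Lemma enorm_ge0 u : 0 <= enorm u. Proof. exact: sqrtr_ge0. Qed.

Lemma enorm_sqr u : enorm u ^+ 2 = dotp u u.
Proof. by rewrite sqr_sqrtr// dotpp_ge0. Qed.

(** Cauchy-Schwarz on the unit ball: with t = <u,v>, expanding 0 <= |u - t v|^2 and using |v| <= 1
    leaves t^2 <= |u|^2. *)
Lemma norm_dotp_le u v : enorm v <= 1 -> `|dotp u v| <= enorm u.
Proof.
move=> v1; have vv1 : dotp v v <= 1.
  by rewrite -enorm_sqr expr_le1// enorm_ge0.
rewrite -(ler_pXn2r (n := 2)) ?nnegrE ?enorm_ge0// enorm_sqr.
rewrite real_normK ?num_real//.
have expand (a : R) : \sum_(i < N) (u i 0 - a * v i 0) ^+ 2 =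
    dotp u u - 2 * a * dotp u v + a ^+ 2 * dotp v v.
  rewrite /dotp !mulr_sumr -sumrN -!big_split/=.
  by apply: eq_bigr => i _; ring.
set t := dotp u v.
have : 0 <= \sum_(i < N) (u i 0 - t * v i 0) ^+ 2.
  by apply: sumr_ge0 => i _; exact: sqr_ge0.
rewrite expand -/t.
have := ler_wpM2l (sqr_ge0 t) vv1.
lra.
Qed.

Lemma norm_coord_le u i : `|u i 0| <= enorm u.
Proof.
rewrite -(ler_pXn2r (n := 2)) ?nnegrE ?enorm_ge0// enorm_sqr.
rewrite real_normK ?num_real//.
rewrite /dotp (bigD1 i)//= -expr2 lerDl.
by apply: sumr_ge0 => j _; rewrite -expr2 sqr_ge0.
Qed.

End euclidean_norm.

(** * Linear features and coercivity of the Gram matrix *)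

Section features.
Context dS dA (S : measurableType dS) (A : measurableType dA) (R : realType).
Local Notation SA := (S * A)%type.
Variables (N : nat) (phi : SA -> 'cV[R]_N).
Hypothesis mphi : forall i, measurable_fun setT (fun x => phi x i 0).
Hypothesis phi_le1 : forall x, enorm (phi x) <= 1.

Lemma bdd_measurable_feature i : bdd_measurable (fun x => phi x i 0).
Proof.
split=> //; exists 1 => x.
by rewrite (le_trans (norm_coord_le _ _)).
Qed.

Lemma norm_Qfun_le theta x : `|Qfun phi theta x| <= enorm theta.
Proof. exact: norm_dotp_le. Qed.

Lemma bdd_measurable_Qfun theta : bdd_measurable (Qfun phi theta).
Proof.
apply: bdd_measurable_sum => i; apply: bdd_measurableZ.
exact: bdd_measurable_feature.
Qed.

(* Instead of diagonalising the Gram matrix, invert it: 0 is not one of its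
   eigenvalues, and every entry of G theta is bounded by the L2 norm of Q. *)
Lemma gram_coercive (beta : probability SA R) : 0 < lambda_beta phi beta ->
  exists2 kappa : R, 0 < kappa & forall theta,
    kappa * dotp theta theta <= \int[beta]_x (Qfun phi theta x ^+ 2).
Proof.
move=> lam; set G := gram phi beta.
have beta_fin : (beta setT < +oo)%E by rewrite ltey_eq fin_num_measure.
have Gunit : G \in unitmx.
  rewrite -row_free_unit -kermx_eq0; apply/negPn/negP => kerG.
  have G0 : eigenvalue G 0 by rewrite /eigenvalue /eigenspace raddf0 subr0.
  have : lambda_beta phi beta <= 0.
    rewrite /lambda_beta /lambda_min.
    (* If the set of eigenvalues has no infimum, [inf] takes the default value 0, which contradicts
       positivity just as well. *)
    have [hi|/inf_out->//] := pselect (has_inf [set a : R | eigenvalue G a]).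
    by apply: ge_inf => //; case: hi.
  by rewrite leNgt lam.
(* [b i] is the l1 norm of row i of the inverse Gram matrix; the added 1 below makes the denominator
   positive outright. *)
pose b i := \sum_(j < N) `|invmx G i j|.
have s0 : 0 < 1 + \sum_(i < N) b i ^+ 2.
  by rewrite ltr_pwDl// sumr_ge0// => i _; rewrite sqr_ge0.
exists (1 + \sum_(i < N) b i ^+ 2)^-1; first by rewrite invr_gt0.
move=> theta; set I2 := \int[beta]_x _.
have I2_ge0 : 0 <= I2 by apply: Rintegral_ge0 => x _; exact: sqr_ge0.
(* Entry j of G theta is the integral of phi_j Q; Jensen and |phi_j| <= 1 bound its square by
   [I2]. *)
have Gtheta j : `|(G *m theta) j 0| <= Num.sqrt I2.
  rewrite -(ler_pXn2r (n := 2)) ?nnegrE ?sqrtr_ge0//.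
  rewrite sqr_sqrtr// real_normK ?num_real//.
  have bj := bdd_measurableM (bdd_measurable_feature j)
    (bdd_measurable_Qfun theta).
  have -> : (G *m theta) j 0 = \int[beta]_x (phi x j 0 * Qfun phi theta x).
    rewrite mxE; under eq_Rintegral do rewrite mulr_sumr.
    rewrite bdd_Rintegral_sum//; last first.
      move=> i; apply: bdd_measurableM; first exact: bdd_measurable_feature.
      by apply: bdd_measurableZ; exact: bdd_measurable_feature.
    apply: eq_bigr => i _; rewrite mxE mulrC -bdd_RintegralZ//; last first.
      by apply: bdd_measurableM; exact: bdd_measurable_feature.
    by apply: eq_Rintegral => x _; ring.
  apply: (le_trans (Rintegral_sqr_le _ bj)); first exact: probability_setT.
  apply: bdd_le_Rintegral => //; try exact: bdd_measurable_sqr.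
    by apply: bdd_measurable_sqr; exact: bdd_measurable_Qfun.
  move=> x; rewrite exprMn ler_piMl ?sqr_ge0//.
  rewrite -real_normK ?num_real// expr_le1//.
  by rewrite (le_trans (norm_coord_le _ _)).
rewrite ler_pdivrMl//.
have thetaE : theta = invmx G *m (G *m theta) by rewrite mulmxA mulVmx// mul1mx.
have thi i : `|theta i 0| <= b i * Num.sqrt I2.
  rewrite {1}thetaE mxE (le_trans (ler_norm_sum _ _ _))// mulr_suml.
  by apply: ler_sum => j _; rewrite normrM ler_wpM2l.
apply: (@le_trans _ _ (\sum_(i < N) b i ^+ 2 * I2)); last first.
  by rewrite -mulr_suml ler_wpM2r// lerDr.
apply: ler_sum => i _; rewrite -expr2 -real_normK ?num_real//.
have b_ge0 : 0 <= b i by apply: sumr_ge0 => j _; exact: normr_ge0.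
rewrite -(sqr_sqrtr I2_ge0) -exprMn.
by rewrite lerXn2r ?nnegrE ?mulr_ge0 ?sqrtr_ge0.
Qed.

End features.

(** * Lower bound on the semi-gradient in the direction of the parameter *)

Section semi_gradient_estimate.
Context dS dA (S : measurableType dS) (A : measurableType dA) (R : realType).
Local Notation SA := (S * A)%type.
Variables (N : nat) (phi : SA -> 'cV[R]_N).
Hypothesis mphi : forall i, measurable_fun setT (fun x => phi x i 0).
Hypothesis phi_le1 : forall x, enorm (phi x) <= 1.
Variables (P : R.-pker SA ~> S) (c : Bb SA R) (mu : probability A R).
Variables (beta : probability SA R) (tau : R) (tau_ge0 : 0 <= tau).
Variables (gamma : R) (gamma01 : 0 < gamma < 1).
Variables (pi : R.-pker S ~> A) (l : Bb SA R).
Hypothesis l_pi : is_log_density mu pi l.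

Local Notation K := (state_action_kernel P pi).
Local Notation occ := (occupancy gamma01 P pi beta).

Let occ_fin : (occ setT < +oo)%E.
Proof. by rewrite (le_lt_trans (occupancy_setT_le1 _ _ _ _))// ltry. Qed.

Let beta_fin : (beta setT < +oo)%E.
Proof. by rewrite ltey_eq fin_num_measure. Qed.

Let K_fin x : (K x setT < +oo)%E. Proof. by rewrite prob_kernel ltry. Qed.

Let P_fin x : (P x setT < +oo)%E. Proof. by rewrite prob_kernel ltry. Qed.

Let r := Num.sqrt gamma.

Let r2 : gamma = r ^+ 2.
Proof. by rewrite sqr_sqrtr//; case/andP: gamma01 => /ltW. Qed.

Let r_ge0 : 0 <= r. Proof. exact: sqrtr_ge0. Qed.

(** The Bellman target with the relative entropy replaced by the mean of [l], hence a bounded real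
    function. *)
Let bellmanR theta x := c x + gamma * \int[K x]_y Qfun phi theta y
  + tau * gamma * \int[P x]_s \int[pi s]_a l (s, a).

Lemma bellmanE theta x :
  bellman P c mu tau gamma pi (Qfun phi theta) x = (bellmanR theta x)%:E.
Proof.
rewrite /bellman /bellmanR !EFinD !EFinM.
rewrite (EFin_Rintegral (K_fin x) (bdd_measurable_Qfun mphi phi_le1 theta)).
rewrite (EFin_Rintegral (P_fin x) (bdd_measurable_log_density_mean pi l)).
congr (_ + _ * _)%E; apply: eq_integral => s _.
exact: KL_log_density.
Qed.

Let bdd_bellmanR theta : bdd_measurable (bellmanR theta).
Proof.
apply: bdd_measurableD; first apply: bdd_measurableD.
- exact: bdd_measurable_Bb.
- apply/bdd_measurableZ/bdd_measurable_kernel; exact: bdd_measurable_Qfun.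
- apply/bdd_measurableZ/bdd_measurable_kernel.
  exact: bdd_measurable_log_density_mean.
Qed.

Lemma dotp_semi_gradient theta :
  dotp theta (semi_gradient phi P c mu beta tau gamma01 theta pi) =
  \int[occ]_x ((Qfun phi theta x - bellmanR theta x) * Qfun phi theta x).
Proof.
have bQT := bdd_measurableB (bdd_measurable_Qfun mphi phi_le1 theta)
  (bdd_bellmanR theta).
under [RHS]eq_Rintegral do rewrite {2}/Qfun /dotp mulr_sumr.
rewrite bdd_Rintegral_sum//; last first.
  move=> i; apply: bdd_measurableM => //; apply: bdd_measurableZ.
  exact: bdd_measurable_feature.
apply: eq_bigr => i _; rewrite mxE.
under eq_integral do rewrite bellmanE -EFinB -EFinM.
rewrite -[fine _]/(\int[occ]_x
  ((Qfun phi theta x - bellmanR theta x) * phi x i 0)).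
rewrite -bdd_RintegralZ//; first by apply: eq_Rintegral => x _; ring.
by apply: bdd_measurableM => //; exact: bdd_measurable_feature.
Qed.

(** A pointwise lower bound is integrated against the occupancy measure; the negative square of the
    kernel mean is absorbed by [step], and [low] then passes to [beta]. *)
Lemma semi_gradient_coercive theta M : (forall x, `|l x| <= M) ->
  (1 - Num.sqrt gamma) * (1 - gamma) * \int[beta]_x (Qfun phi theta x ^+ 2)
    - (Bb_norm c + tau * gamma * M) * enorm theta <=
  dotp theta (semi_gradient phi P c mu beta tau gamma01 theta pi).
Proof.
move=> lM; rewrite dotp_semi_gradient -/r.
have bQ := bdd_measurable_Qfun mphi phi_le1 theta.
have bQ2 := bdd_measurable_sqr bQ.
have bKQ : bdd_measurable (fun x => \int[K x]_y Qfun phi theta y).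
  exact: bdd_measurable_kernel.
have bKQ2 := bdd_measurable_sqr bKQ.
have bK2 : bdd_measurable (fun x => \int[K x]_y (Qfun phi theta y ^+ 2)).
  exact: bdd_measurable_kernel.
have M0 : 0 <= M by rewrite (le_trans _ (lM point)).
set Q := Qfun phi theta in bQ bQ2 bKQ bKQ2 bK2 *.
set D := (Bb_norm c + tau * gamma * M) * enorm theta.
have c0 : 0 <= Bb_norm c by rewrite (le_trans _ (Bb_norm_ub c point)).
have gamma_ge0 : 0 <= gamma by case/andP: gamma01 => /ltW.
have r1 : 0 <= 1 - r.
  rewrite subr_ge0 -sqrtr1 ler_wsqrtr//.
  by case/andP: gamma01 => _ /ltW.
have D0 : 0 <= D by rewrite mulr_ge0 ?enorm_ge0// addr_ge0// !mulr_ge0.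
(* With gamma = r^2, AM-GM gives gamma k Q = r (r k) Q <= (r/2)(gamma k^2 + Q^2); cost and entropy
   go into [D]. *)
have pw x : (1 - r / 2) * Q x ^+ 2
    - r / 2 * gamma * (\int[K x]_y Q y) ^+ 2 - D <=
    (Q x - bellmanR theta x) * Q x.
  rewrite /bellmanR -/Q.
  set k := \int[K x]_y Q y; set L := \int[P x]_s _.
  have LM : `|L| <= M.
    apply: Rintegral_norm_le => //; first by rewrite prob_kernel.
      exact: bdd_measurable_log_density_mean.
    move=> s; apply: Rintegral_norm_le; rewrite ?prob_kernel ?ltry//.
    exact/bdd_measurable_section/bdd_measurable_Bb.
  have cL : `|(c x + tau * gamma * L) * Q x| <= D.
    rewrite normrM ler_pM ?norm_Qfun_le//.
    rewrite (le_trans (ler_normD _ _))// lerD ?Bb_norm_ub//.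
    by rewrite normrM ger0_norm ?mulr_ge0// ler_wpM2l// mulr_ge0.
  have := ler_norm ((c x + tau * gamma * L) * Q x).
  have : 0 <= r / 2 * (r * k - Q x) ^+ 2.
    by rewrite mulr_ge0 ?sqr_ge0// divr_ge0.
  rewrite r2.
  move: cL; rewrite r2 => cL h1 h2.
  have {cL h2} := le_trans h2 cL.
  move: h1; lra.
have bDc : bdd_measurable (fun _ : SA => D) := bdd_measurable_cst D.
have b1 := bdd_measurableZ (1 - r / 2) bQ2.
have b2 := bdd_measurableZ (r / 2 * gamma) bKQ2.
have := bdd_le_Rintegral occ_fin (bdd_measurableB (bdd_measurableB b1 b2) bDc)
  (bdd_measurableM (bdd_measurableB bQ (bdd_bellmanR theta)) bQ) pw.
apply: le_trans.
rewrite (bdd_RintegralB occ_fin (bdd_measurableB b1 b2) bDc).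
rewrite (bdd_RintegralB occ_fin b1 b2).
rewrite (bdd_RintegralZ occ_fin _ bQ2) (bdd_RintegralZ occ_fin _ bKQ2).
rewrite Rintegral_cst//.
have occD : D * fine (occ setT) <= D.
  rewrite ler_piMr// -lee_fin fineK ?ge0_fin_numE//.
  exact: occupancy_setT_le1.
have Q2_ge0 x : (0 <= (Q x ^+ 2)%:E)%E by rewrite lee_fin sqr_ge0.
have mQ2 : measurable_fun setT (fun x => (Q x ^+ 2)%:E).
  by apply/measurable_EFinP; case: bQ2.
(* Jensen for [K x] comes first, then the domination of gamma times the occupancy measure pushed by
   [K]. The remaining coefficient of Q^2 is 1 - r/2 - r/2 = 1 - r. *)
have step :
    gamma * \int[occ]_x ((\int[K x]_y Q y) ^+ 2) <= \int[occ]_x (Q x ^+ 2).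
  apply: (@le_trans _ _ (gamma * \int[occ]_x \int[K x]_y (Q y ^+ 2))).
    apply: ler_wpM2l => //; apply: bdd_le_Rintegral => // x.
    by apply: Rintegral_sqr_le => //; exact: prob_kernel.
  rewrite -lee_fin EFinM EFin_Rintegral// EFin_Rintegral//.
  under eq_integral do rewrite EFin_Rintegral//.
  exact: integral_kernel_le_occupancy.
have low : (1 - gamma) * \int[beta]_x (Q x ^+ 2) <= \int[occ]_x (Q x ^+ 2).
  rewrite -lee_fin EFinM EFin_Rintegral// EFin_Rintegral//.
  exact: integral_le_occupancy.
have := ler_wpM2l r1 low.
have := ler_wpM2l r_ge0 step.
move: occD.
lra.
Qed.

End semi_gradient_estimate.

(** * Scalar calculus and a comparison principle on the half-line *)

Section halfline.
Context (R : realType).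
Implicit Types (f g h : R -> R) (t d : R).

(** The relational form of [derive_halfline] for real functions: calculus rules then carry existence
    and value of the derivative together. *)
Definition halfline_slope f t d : Prop :=
  (fun s => (s - t)^-1 * (f s - f t)) @ within [set s | 0 <= s] t^' --> d.

Lemma near_halfline t (A : set R) : within [set s | 0 <= s] t^' A <->
  exists2 del, 0 < del &
    forall s, 0 <= s -> s != t -> `|s - t| < del -> A s.
Proof.
rewrite /within /dnbhs /within; split.
  move=> /nbhs_ballP[del /= del0 tdel]; exists del => // s s0 st std.
  by apply: tdel => //; rewrite /ball/= distrC.
move=> [del del0 sdel]; apply/nbhs_ballP; exists del => //= s.
by rewrite /ball/= distrC => std st s0; exact: sdel.
Qed.

Lemma halfline_slopeP f t d : halfline_slope f t d <->
  forall e, 0 < e -> exists2 del, 0 < del &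
    forall s, 0 <= s -> s != t -> `|s - t| < del ->
      `|d - (s - t)^-1 * (f s - f t)| < e.
Proof.
split.
  by move=> /cvgrPdist_lt fd e e0; exact/near_halfline/fd.
by move=> fd; apply/cvgrPdist_lt => e e0; exact/near_halfline/fd.
Qed.

Lemma halfline_slope_continuous f t d : halfline_slope f t d ->
  f @ within [set s | 0 <= s] t^' --> f t.
Proof.
move=> /halfline_slopeP fd; apply/cvgrPdist_lt => e e0.
have [del del0 sdel] := fd 1 ltr01.
have d1 : 0 < `|d| + 1 by rewrite ltr_pwDr.
(* Near [t] the difference quotient is smaller than |d| + 1 in absolute value, hence this radius. *)
apply/near_halfline; exists (Num.min del (e / (`|d| + 1))).
  by rewrite lt_min del0 divr_gt0.
move=> s s0 st; rewrite lt_min => /andP[std ste].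
have st0 : 0 < `|s - t| by rewrite normr_gt0 subr_eq0.
have := sdel s s0 st std.
rewrite distrC => /(le_lt_trans (lerB_dist _ _)).
rewrite ltrBlDl normrM normfV ltr_pdivrMl// distrC => h.
by rewrite (lt_trans h)// -ltr_pdivlMr// addrC.
Qed.

Lemma halfline_slope_cst k t : halfline_slope (fun _ => k) t 0.
Proof.
rewrite /halfline_slope.
under eq_fun do rewrite subrr mulr0.
exact: cvg_cst.
Qed.

Lemma halfline_slopeD f g t d e : halfline_slope f t d ->
  halfline_slope g t e -> halfline_slope (fun s => f s + g s) t (d + e).
Proof.
move=> fd ge; rewrite /halfline_slope.
rewrite [X in X @ _](_ : _ = (fun s => (s - t)^-1 * (f s - f t)) \+
  (fun s => (s - t)^-1 * (g s - g t))); first exact: cvgD.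
by apply/funext => s /=; ring.
Qed.

Lemma halfline_slopeM f g t d e : halfline_slope f t d ->
  halfline_slope g t e ->
  halfline_slope (fun s => f s * g s) t (d * g t + f t * e).
Proof.
move=> fd ge; rewrite /halfline_slope.
rewrite [X in X @ _](_ : _ = (fun s => (s - t)^-1 * (f s - f t)) \* g \+
  (fun _ => f t) \* (fun s => (s - t)^-1 * (g s - g t))); last first.
  by apply/funext => s /=; ring.
apply: cvgD; apply: cvgM => //; last exact: cvg_cst.
exact: halfline_slope_continuous ge.
Qed.

Lemma halfline_slopeZ k f t d : halfline_slope f t d ->
  halfline_slope (fun s => k * f s) t (k * d).
Proof.
move=> fd; have := halfline_slopeM (halfline_slope_cst k t) fd.
by rewrite mul0r add0r.
Qed.

Lemma halfline_slopeB f g t d e : halfline_slope f t d ->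
  halfline_slope g t e -> halfline_slope (fun s => f s - g s) t (d - e).
Proof.
move=> fd ge; have := halfline_slopeD fd (halfline_slopeZ (k := -1) ge).
by rewrite mulN1r; under eq_fun do rewrite mulN1r.
Qed.

Lemma halfline_slope_sum n (F : 'I_n -> R -> R) (D : 'I_n -> R) t :
  (forall i, halfline_slope (F i) t (D i)) ->
  halfline_slope (fun s => \sum_(i < n) F i s) t (\sum_(i < n) D i).
Proof.
elim: n F D => [|n IH] F D FD.
  rewrite big_ord0; under eq_fun do rewrite big_ord0.
  exact: halfline_slope_cst.
rewrite big_ord_recl; under eq_fun do rewrite big_ord_recl.
by apply: halfline_slopeD => //; apply: IH.
Qed.

Lemma halfline_slope_derive f t d : is_derive t (1 : R) f d ->
  halfline_slope f t d.
Proof.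
move=> [df fd]; have : h^-1 *: (f (h *: 1 + t) - f t) @[h --> 0^'] --> d.
  by rewrite -fd; exact: df.
move=> /cvgrPdist_lt hd; apply/halfline_slopeP => e e0.
have /nbhs_ballP[del /= del0 h0] : nbhs (0 : R) (fun k : R => k != 0 ->
    `|d - k^-1 *: (f (k *: 1 + t) - f t)| < e) := hd e e0.
exists del => // s s0 st std.
have := h0 (s - t); rewrite /ball/= sub0r normrN => /(_ std).
rewrite subr_eq0 => /(_ st).
by rewrite /GRing.scale/= mulr1 subrK.
Qed.

Lemma halfline_slope_expR k t :
  halfline_slope (fun s => expR (k * s)) t (k * expR (k * t)).
Proof.
apply: halfline_slope_derive.
have dk : is_derive t (1 : R) ( *%R k) k.
  have := is_deriveZ k (is_derive_id t (1 : R)).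
  by rewrite /GRing.scale/= mulr1.
have := is_derive1_comp (is_derive_expR (k * t)) dk.
by rewrite mulrC.
Qed.

(** Transfers derivatives from a normed space to scalars: [L] commutes with difference quotients and
    does not increase distances. It serves for evaluation on [Bb] and for vector coordinates. *)
Lemma halfline_slope_linear (V : normedModType R) (L : V -> R) (f : R -> V) t :
  (forall a u v, L (a *: (u - v)) = a * (L u - L v)) ->
  (forall v, `|L v| <= `|v|) ->
  derivable_halfline f t ->
  halfline_slope (fun s => L (f s)) t (L (derive_halfline f t)).
Proof.
move=> Llin Lle fd.
have {}fd : halfline_quotient f t --> derive_halfline f t by exact: fd.
apply/cvgrPdist_lt => e e0.
move/cvgrPdist_lt : fd => /(_ e e0); apply: filterS => s.
apply: le_lt_trans.
set q := _ *: _; rewrite -Llin -/q.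
have := Llin 1 (derive_halfline f t) q; rewrite mul1r => <-.
by rewrite scale1r.
Qed.

(* A comparison argument at the supremum of the times up to which h <= 0:
   a first zero would be reached with negative slope from below. *)
Lemma halfline_barrier h (dh : R -> R) T :
  (forall t, 0 <= t <= T -> halfline_slope h t (dh t)) ->
  h 0 < 0 ->
  (forall t, 0 < t <= T -> (forall s, 0 <= s <= t -> h s <= 0) -> h t = 0 ->
    dh t < 0) ->
  forall t, 0 <= t <= T -> h t <= 0.
Proof.
move=> hdh h0 barrier t1 /andP[t10 t1T]; rewrite leNgt; apply/negP => ht1.
have cont t : 0 <= t <= T -> forall e, 0 < e -> exists2 del, 0 < del &
    forall s, 0 <= s -> `|s - t| < del -> `|h t - h s| < e.
  move=> tT e e0; have /halfline_slope_continuous/cvgrPdist_lt := hdh t tT.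
  move=> /(_ e e0) /near_halfline[del del0 sd].
  exists del => // s s0 std.
  have [->|st] := eqVneq s t; first by rewrite subrr normr0.
  exact: sd.
(* Asking for h <= 0 on the whole of [0, s] makes every time before the supremum inherit the
   sign. *)
pose E := [set s | 0 <= s <= t1 /\ forall r, 0 <= r <= s -> h r <= 0].
have E0 : E 0.
  split; first by rewrite lexx.
  by move=> r /le_anti <-; exact: ltW.
have Eub : ubound E t1 by move=> s [/andP[]].
have hE : has_sup E by split; [exists 0|exists t1].
pose t := sup E.
have t0 : 0 <= t by apply: ub_le_sup => //; exists t1.
have tt1 : t <= t1 by apply: ge_sup => //; exists 0.
have tT : 0 <= t <= T by rewrite t0 (le_trans tt1).
have before r : 0 <= r -> r < t -> h r <= 0.
  move=> r0 rt; have := @sup_adherent R E (t - r).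
  rewrite subr_gt0 => /(_ rt hE)[s [_ sE]]; rewrite subKr => rs.
  by apply: sE; rewrite r0 ltW.
have tneq0 : h t >= 0 -> 0 < t.
  move=> ht; rewrite lt_neqAle t0 andbT; apply/eqP => t00.
  by move: ht; rewrite -t00 leNgt h0.
(* Approach to [t] from the left; the maximum with 0 keeps the point in the half-line. *)
have left del : 0 < t -> 0 < del -> exists s, [/\ 0 <= s, s < t & `|s - t| < del].
  move=> tp del0; exists (Num.max 0 (t - del / 2)).
  split; first by rewrite le_max lexx.
    by rewrite gt_max tp gtrBl divr_gt0.
  rewrite ltr0_norm; last by rewrite subr_lt0 gt_max tp gtrBl divr_gt0.
  rewrite opprB ltrBlDr -ltrBlDl lt_max; apply/orP; right.
  by rewrite ltrD2l ltrN2 ltr_pdivrMr// ltr_pMr// ltr1n.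
have ht_le0 : h t <= 0.
  rewrite leNgt; apply/negP => ht.
  have [del del0 sdel] := cont t tT _ ht.
  have [s [s0 st std]] := left del (tneq0 (ltW ht)) del0.
  have := sdel s s0 std; have := before s s0 st.
  by rewrite ltr_norml => hs /andP[_]; lra.
have Et s : 0 <= s <= t -> h s <= 0.
  by move=> /andP[s0]; rewrite le_eqVlt => /predU1P[->//|]; exact: before.
have ltt1 : t < t1.
  rewrite lt_neqAle tt1 andbT; apply/eqP => tE.
  by move: ht1; rewrite -tE ltNge ht_le0.
(* If h t = 0, the left quotients are nonnegative although their limit [dh t] is negative. If h t <
   0, continuity keeps h <= 0 up to some u > t, against the choice of [t] as supremum. *)
move: (ht_le0); rewrite le_eqVlt => /predU1P[ht|ht].
  have tp : 0 < t by apply: tneq0; rewrite ht.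
  have dneg : dh t < 0 by apply: barrier => //; rewrite tp (le_trans tt1).
  have dpos : 0 < - dh t by rewrite oppr_gt0.
  have /halfline_slopeP/(_ _ dpos)[del del0 sdel] := hdh t tT.
  have [s [s0 st std]] := left del tp del0.
  have := sdel s s0 (negbT (lt_eqF st)) std.
  rewrite ht subr0 ltr_norml => /andP[+ _].
  have hs := before s s0 st.
  have : 0 <= (s - t)^-1 * h s.
    by rewrite mulr_le0// invr_le0 subr_le0 ltW.
  by lra.
have nht : 0 < - h t by rewrite oppr_gt0.
have [del del0 sdel] := cont t tT _ nht.
pose u := Num.min t1 (t + del / 2).
have tu : t < u by rewrite lt_min ltt1 ltrDl divr_gt0.
have : u <= t.
  apply: ub_le_sup; first by exists t1.
  split; first by rewrite (le_trans t0 (ltW tu)) ge_min lexx.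
  move=> r /andP[r0 ru]; have [rt|tr] := leP r t; first by apply: Et; rewrite r0.
  have : `|r - t| < del.
    rewrite gtr0_norm ?subr_gt0// ltrBlDl (le_lt_trans ru)// gt_min.
    by apply/orP; right; rewrite ltrD2l ltr_pdivrMr// ltr_pMr// ltr1n.
  move=> /(sdel r r0); rewrite ltr_norml => /andP[+ _].
  by lra.
by rewrite leNgt tu.
Qed.

End halfline.

(** * Growth of the log-density along the flow *)

Section flow.
Context dS dA (S : measurableType dS) (A : measurableType dA) (R : realType).
Local Notation SA := (S * A)%type.
Variables (N : nat) (phi : SA -> 'cV[R]_N).
Hypothesis mphi : forall i, measurable_fun setT (fun x => phi x i 0).
Hypothesis phi_le1 : forall x, enorm (phi x) <= 1.
Variables (mu : probability A R) (tau : R) (tau_gt0 : 0 < tau).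
Variables (theta : R -> 'cV[R]_N) (pi : R -> R.-pker S ~> A).
Variable l : R -> Bb SA R.
Hypothesis l_pi : forall t, 0 <= t -> is_log_density mu (pi t) (l t).
Hypothesis dl : forall t, 0 <= t -> derivable_halfline l t.
Hypothesis lE : forall t, 0 <= t -> forall s a,
  derive_halfline l t (s, a) = - advantage phi tau (theta t) (pi t) (l t) s a.

Lemma halfline_slope_Bb t x : 0 <= t ->
  halfline_slope (fun s => l s x) t (derive_halfline l t x).
Proof.
move=> t0; apply: (@halfline_slope_linear _ _ (fun f : Bb SA R => f x)) => //.
- by move=> v; exact: Bb_norm_ub.
- exact: dl.
Qed.

(* The normalisation term of the advantage cancels in l(s,a) - l(s,a'), which
   satisfies D' <= 2|theta| - tau D. *)
Lemma flow_log_density_le b r T : 0 < b -> 0 < r -> 0 <= T ->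
  (forall s, 0 <= s <= T -> enorm (theta s) <= b * expR (r * s)) ->
  forall x, `|l T x| <= 2 * Bb_norm (l 0) + 2 * b / r * expR (r * T).
Proof.
move=> b0 r0 T0 thb [s a].
set C := 2 * Bb_norm (l 0); set k := 2 * b / r.
have kr : k * r = 2 * b by rewrite /k divfK// gt_eqF.
have k0 : 0 < k by rewrite /k divr_gt0// mulr_gt0.
have C0 : 0 <= C by rewrite mulr_ge0// (le_trans _ (Bb_norm_ub (l 0) point)).
apply: (log_density_norm_le (l_pi T0)) => {}a a'; rewrite -subr_le0.
(* The comparison function C + k exp(r t) has slope 2 b exp(r t), the bound on 2|theta|, because k =
   2 b / r; [C] dominates the initial oscillation and k > 0 makes the start strict. *)
pose h t := (l t (s, a) - l t (s, a')) - (C + k * expR (r * t)).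
pose dh t := (derive_halfline l t (s, a) - derive_halfline l t (s, a'))
  - (0 + k * (r * expR (r * t))).
have TT : 0 <= T <= T by rewrite T0 lexx.
apply: (@halfline_barrier _ h dh T _ _ _ T TT).
- move=> t /andP[t0 _].
  apply: halfline_slopeB.
    by apply: halfline_slopeB; exact: halfline_slope_Bb.
  apply: halfline_slopeD; first exact: halfline_slope_cst.
  by apply: halfline_slopeZ; exact: halfline_slope_expR.
- rewrite /h mulr0 expR0 mulr1.
  have := Bb_norm_ub (l 0) (s, a); have := Bb_norm_ub (l 0) (s, a').
  rewrite !ler_norml => /andP[h1 _] /andP[_ h2].
  by rewrite /C; lra.
- move=> t /andP[t0 tT] _ ht; rewrite /dh !lE ?(ltW t0)// /advantage.
  have tb : 0 <= t <= T by rewrite ltW.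
  have := norm_Qfun_le phi_le1 (theta t) (s, a).
  have := norm_Qfun_le phi_le1 (theta t) (s, a').
  rewrite !ler_norml => /andP[_ h1] /andP[h2 _].
  have h3 := thb t tb.
  have D_E : l t (s, a) - l t (s, a') = C + k * expR (r * t).
    by apply/eqP; rewrite -subr_eq0; apply/eqP.
  have e0 := expR_gt0 (r * t).
  (* At a contact time the difference equals the positive comparison function, so the damping by
     [tau] makes the slope strictly negative. *)
  have : 0 < tau * (l t (s, a) - l t (s, a')).
    by rewrite D_E mulr_gt0// ltr_wpDl// mulr_gt0.
  rewrite mulrA kr.
  lra.
Qed.

End flow.

(** * Derivative of the squared Euclidean norm *)

Section euclidean_slope.
Context (R : realType) (N : nat).
Implicit Types u : 'cV[R]_N.

Lemma norm_coord_le_mx_norm u i : `|u i 0| <= `|u|.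
Proof.
rewrite [leRHS]/Num.Def.normr/= mx_normrE.
exact: (le_bigmax _ (fun ij : 'I_N * 'I_1 => `|u ij.1 ij.2|) (i, 0)).
Qed.

(** [theta] is differentiable in the max norm, for which coordinates are nonexpansive, so the
    product rule applies coordinatewise. *)
Lemma halfline_slope_dotp (theta : R -> 'cV[R]_N) t :
  derivable_halfline theta t ->
  halfline_slope (fun s => dotp (theta s) (theta s)) t
    (2 * dotp (theta t) (derive_halfline theta t)).
Proof.
move=> dth; rewrite /dotp mulr_sumr.
apply: halfline_slope_sum => i.
have thi : halfline_slope (fun s => theta s i 0) t (derive_halfline theta t i 0).
  apply: (@halfline_slope_linear _ _ (fun u : 'cV[R]_N => u i 0)) => //.
    by move=> a u v; rewrite !mxE.
  by move=> v; exact: norm_coord_le_mx_norm.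
have := halfline_slopeM thi thi.
by congr (halfline_slope _ _ _); ring.
Qed.

End euclidean_slope.

(** * The exponential bound on the critic parameter *)

Theorem corollary5p2 (R : realType) (S A : ptopologicalType)
    (polishS : polish R S) (polishA : polish R A)
    (P : R.-pker (borel S * borel A) ~> borel S)
    (c : Bb (borel S * borel A)%type R)
    (mu : probability (borel A) R)
    (beta : probability (borel S * borel A)%type R)
    (gamma : R) (gamma01 : 0 < gamma < 1)
    (tau : R) (tau_gt0 : 0 < tau)
    (N : nat) (phi : borel S * borel A -> 'cV[R]_N)
    (mphi : forall i, measurable_fun [set: borel S * borel A]
                        (fun x => phi x i 0))
    (phi_le1 : forall x, enorm (phi x) <= 1)
    (lambda_gt0 : 0 < lambda_beta phi beta)
    (eta : R -> R)
    (eta_ge1 : forall t, 0 <= t -> 1 <= eta t)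
    (eta_ndecr : forall s t, 0 <= s -> s <= t -> eta s <= eta t)
    (eta0 : tau / Gamma_beta phi beta gamma < eta 0)
    (eta_derivable : forall t, 0 <= t -> derivable_halfline (eta : R -> R^o) t)
    (alpha : R) (alpha_gt0 : 0 < alpha)
    (eta_growth : forall t, 0 <= t ->
       derive_halfline (eta : R -> R^o) t <= alpha * eta t)
    (theta : R -> 'cV[R]_N)
    (pi : R -> R.-pker (borel S) ~> (borel A))
    (flow : actor_critic_flow phi P c mu beta tau gamma01 eta theta pi) :
  exists r1 r2 : R, [/\ 0 < r1, 0 < r2 &
    forall t, 0 <= t -> enorm (theta t) <= r1 * expR (r2 * t)].
Proof.
case: flow => l flow.
have l_pi t : 0 <= t -> is_log_density mu (pi t) (l t) by case/flow.
have dl t : 0 <= t -> derivable_halfline l t by case/flow.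
have dth t : 0 <= t -> derivable_halfline theta t by case/flow.
have lE t : 0 <= t -> forall s a,
    derive_halfline l t (s, a) = - advantage phi tau (theta t) (pi t) (l t) s a.
  by case/flow.
have thE t : 0 <= t -> derive_halfline theta t =
    - eta t *: semi_gradient phi P c mu beta tau gamma01 (theta t) (pi t).
  by case/flow.
have [kappa kappa0 coercive] := gram_coercive mphi phi_le1 lambda_gt0.
have [g0 g1] := andP gamma01.
pose G := (1 - Num.sqrt gamma) * (1 - gamma) * kappa.
have sg1 : 0 < 1 - Num.sqrt gamma.
  by rewrite subr_gt0 -[ltRHS]sqrtr1 ltr_sqrt.
have G0 : 0 < G by rewrite !mulr_gt0// subr_gt0.
pose C := Bb_norm c + 2 * tau * Bb_norm (l 0).
have c0 : 0 <= Bb_norm c by rewrite (le_trans _ (Bb_norm_ub c point)).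
have l0 : 0 <= Bb_norm (l 0) by rewrite (le_trans _ (Bb_norm_ub (l 0) point)).
have C0 : 0 <= C by rewrite addr_ge0// !mulr_ge0// ltW.
(* This [r] gives tau (2 b / r) = G b / 2, so the growing part of the log-density bound uses up half
   of the coercive term. In [b], 1 + |theta_0| makes the start strict, and 2 C / G lets the other
   half exceed [C]. *)
pose r := 4 * tau / G.
pose b := 1 + enorm (theta 0) + 2 * C / G.
have r_gt0 : 0 < r by rewrite divr_gt0// mulr_gt0.
have CG : 0 <= 2 * C / G by rewrite divr_ge0 ?(ltW G0)// mulr_ge0.
have th0 := enorm_ge0 (theta 0).
have b0 : 0 < b by rewrite /b; lra.
exists b, r; split=> // T T0.
(* Squares are compared because the norm itself need not be differentiable at the origin. *)
pose h t := dotp (theta t) (theta t) - b ^+ 2 * expR (2 * r * t).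
pose dh t := 2 * dotp (theta t) (derive_halfline theta t)
  - b ^+ 2 * (2 * r * expR (2 * r * t)).
have hE t : h t = enorm (theta t) ^+ 2 - (b * expR (r * t)) ^+ 2.
  rewrite /h enorm_sqr exprMn [expR _ ^+ 2]expr2 -expRD.
  by congr (_ - _ * expR _); ring.
have hle t : (h t <= 0) = (enorm (theta t) <= b * expR (r * t)).
  rewrite hE subr_le0 ler_pXn2r// nnegrE ?enorm_ge0//.
  by rewrite mulr_ge0 ?expR_ge0// ltW.
rewrite -hle.
have TT : 0 <= T <= T by rewrite T0 lexx.
apply: (@halfline_barrier _ h dh T _ _ _ T TT).
- move=> t /andP[t0 _]; apply: halfline_slopeB.
    exact/halfline_slope_dotp/dth.
  by apply: halfline_slopeZ; exact: halfline_slope_expR.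
- rewrite hE mulr0 expR0 mulr1 subr_lt0 ltr_pXn2r ?nnegrE ?(ltW b0)//.
  by rewrite /b; lra.
move=> t /andP[/ltW t0 tT] below ht.
have thb s : 0 <= s <= t -> enorm (theta s) <= b * expR (r * s).
  by move=> /below; rewrite hle.
have lM := flow_log_density_le phi_le1 tau_gt0 l_pi dl lE b0 r_gt0 t0 thb.
set e := expR (r * t) in lM.
have e1 : 1 <= e by rewrite /e -expR0 ler_expR mulr_ge0// ltW.
have x_e : enorm (theta t) = b * e.
  move/eqP: ht; rewrite hE subr_eq0 eqrXn2 ?enorm_ge0//; first by move/eqP.
  by rewrite mulr_ge0 ?expR_ge0// ltW.
have be0 : 0 < b * e by rewrite mulr_gt0// expR_gt0.
have := semi_gradient_coercive mphi phi_le1 P c beta (ltW tau_gt0) gamma01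
  (l_pi t t0) (theta t) lM.
set g := semi_gradient _ _ _ _ _ _ _ _ _ => grad.
have dotpZ u (k : R) (v : 'cV[R]_N) : dotp u (k *: v) = k * dotp u v.
  by rewrite /dotp mulr_sumr; apply: eq_bigr => i _; rewrite mxE; ring.
rewrite /dh thE// -/g dotpZ.
(* The slope is -2 eta_t <theta,g> minus a positive term, so with eta_t >= 1 only the sign of
   <theta,g> matters. *)
suff gpos : 0 < dotp (theta t) g.
  have := mulr_gt0 (lt_le_trans ltr01 (eta_ge1 t t0)) gpos.
  have : 0 < b ^+ 2 * (2 * r * expR (2 * r * t)).
    apply: mulr_gt0; first exact: exprn_gt0.
    by apply: mulr_gt0; [exact: mulr_gt0|exact: expR_gt0].
  by lra.
apply: lt_le_trans grad.
have I2 := ler_wpM2l (ltW (mulr_gt0 sg1 _)) (coercive (theta t)).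
have {I2} := I2 (1 - gamma).
rewrite subr_gt0 => /(_ g1).
rewrite mulrA -/G -enorm_sqr x_e => I2.
(* At the contact time |theta| = b e, which factors out of the lower bound. *)
apply: (@lt_le_trans _ _ (b * e * (G * (b * e) -
    (Bb_norm c + tau * gamma * (2 * Bb_norm (l 0) + 2 * b / r * e)))));
  last by move: I2; lra.
rewrite mulr_gt0// subr_gt0.
have rE : tau * (2 * b / r) = G * b / 2.
  by rewrite /r; field; rewrite !gt_eqF.
set M := 2 * Bb_norm (l 0) + _.
have M0 : 0 <= M.
  apply: addr_ge0; first exact: mulr_ge0.
  apply: mulr_ge0; last by rewrite expR_ge0.
  by rewrite divr_ge0 ?(ltW r_gt0)// mulr_ge0// ltW.
have : tau * gamma * M <= tau * M.
  by rewrite ler_wpM2r// ler_piMr// ltW.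
have -> : tau * M = 2 * tau * Bb_norm (l 0) + G * b / 2 * e.
  by rewrite /M -rE; ring.
(* The half left over, G b e / 2, exceeds [C] at time zero by the choice of [b], and later because e
   >= 1. *)
have GC : 2 * C < G * b.
  rewrite -ltr_pdivrMl// mulrC /b; lra.
have : 2 * C < G * b * e.
  by rewrite (lt_le_trans GC)// ler_peMr// mulr_ge0 ?ltW.
by rewrite /C; lra.
Qed.
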